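(* Let $\mathcal{C}$ be a finitely complete, finitely co-well-complete category. Then there exist order-preserving bijections \[ \left(\mathrm{coRefl}(\mathcal{C})\right)^{\mathrm{op}} \cong \mathrm{coLoc}(\mathcal{C}) \cong \mathrm{IdemcoMonads}(\mathcal{C}) \] between the partially-ordered collection of replete coreflective subcategories of $\mathcal{C}$, the partially-ordered collection of Bousfield colocalizations of the discrete model structure on $\mathcal{C}$, and the partially-ordered collection of natural equivalence classes of idempotent comonads on $\mathcal{C}$.
   Context: A model category is a finitely complete, finitely co-complete category with three classes of morphisms closed under retracts (cofibrations, weak equivalences, fibrations) such that: each morphism factors as an acyclic cofibration followed by a fibration, and as a cofibration followed by an acyclic fibration; weak equivalences have the two-out-of-three property; the cofibrations are precisely the maps with the left lifting property with respect to acyclic fibrations; the acyclic cofibrations are precisely the maps with the left lifting property with respect to the fibrations. (''Acyclic'' means also a weak equivalence.) All limits and colimits are not assumed to exist, factorizations are not part of the structure, and factorizations are not assumed functorial. The discrete model structure: all maps are cofibrations and fibrations, and the weak equivalences are the isomorphisms. A Bousfield colocalization of a model category $\mathcal{M}$ is a model category $\mathcal{M}'$ with the same underlying category, the same fibrations, and whose collection of weak equivalences contains that of $\mathcal{M}$. A coreflective subcategory is a full subcategory whose inclusion functor admits a right adjoint; replete means closed under isomorphisms. A category $\mathcal{D}$ is finitely well-complete if it has finite limits and, for every collection (not necessarily a set) of strong monomorphisms with common codomain, the pullback of the family exists, where a strong monomorphism is a map with the right lifting property with respect to all epimorphisms. $\mathcal{C}$ is finitely co-well-complete if $\mathcal{C}^{\mathrm{op}}$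 is finitely well-complete. An idempotent comonad on $\mathcal{C}$ is an idempotent monad on $\mathcal{C}^{\mathrm{op}}$, where a monad $(T,\eta,\mu)$ is idempotent if for all objects $X$ both $T\eta X,\ \eta TX:TX\to TTX$ are isomorphisms. Two idempotent comonads are naturally equivalent if there is a morphism of comonads between them which is a natural equivalence of underlying functors. Orderings (the collections are not necessarily sets): $\mathrm{coRefl}(\mathcal{C})$ is ordered by inclusion; in $\mathrm{coLoc}(\mathcal{C})$, $X\le Y$ if and only if $Y$ is a Bousfield colocalization of $X$; in $\mathrm{IdemcoMonads}(\mathcal{C})$, $[S]\le [T]$ if and only if there exists a morphism of comonads $T\to S$ on $\mathcal{C}$ (equivalently a morphism of monads $S\to T$ on $\mathcal{C}^{\mathrm{op}}$). *)

(* Defs.v *)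
From Stdlib Require Import FinFun.
From Stdlib Require Import FunctionalExtensionality PropExtensionality ProofIrrelevance
  ClassicalEpsilon.

Set Implicit Arguments.
Unset Strict Implicit.

Record category := Category {
  ob :> Type;
  hom : ob -> ob -> Type;
  id : forall x, hom x x;
  comp : forall x y z, hom y z -> hom x y -> hom x z;
  comp_id_l : forall x y (f : hom x y), comp (id y) f = f;
  comp_id_r : forall x y (f : hom x y), comp f (id x) = f;
  comp_assoc : forall w x y z (h : hom y z) (g : hom x y) (f : hom w x),
    comp h (comp g f) = comp (comp h g) f
}.

Arguments hom {c} x y.
Arguments id {c} x.
Arguments comp {c x y z} g f.
Arguments comp_id_l {c x y} f.
Arguments comp_id_r {c x y} f.
Arguments comp_assoc {c w x y z} h g f.

Declare Scope cat_scope.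
Delimit Scope cat_scope with cat.
Notation "g ∘ f" := (comp g f) (at level 40, left associativity) : cat_scope.
Open Scope cat_scope.

Definition op (C : category) : category :=
  @Category (ob C) (fun x y => @hom C y x) (@id C)
    (fun x y z g f => comp (c := C) f g)
    (fun x y f => comp_id_r f)
    (fun x y f => comp_id_l f)
    (fun w x y z h g f => eq_sym (comp_assoc (c := C) f g h)).

Definition is_iso (C : category) (x y : C) (f : hom x y) : Prop :=
  exists g : hom y x, g ∘ f = id x /\ f ∘ g = id y.

Definition is_epi (C : category) (x y : C) (f : hom x y) : Prop :=
  forall z (g h : hom y z), g ∘ f = h ∘ f -> g = h.

(** [f] has the left lifting property with respect to [g]. *)
Definition lifts (C : category) (a b x y : C) (f : hom a b) (g : hom x y) : Prop :=
  forall (u : hom a x) (v : hom b y), g ∘ u = v ∘ f ->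
  exists d : hom b x, d ∘ f = u /\ g ∘ d = v.

Definition is_retract (C : category) (a b x y : C) (f : hom a b) (g : hom x y) : Prop :=
  exists (i : hom a x) (r : hom x a) (j : hom b y) (s : hom y b),
    r ∘ i = id a /\ s ∘ j = id b /\ g ∘ i = j ∘ f /\ f ∘ r = s ∘ g.

Record functor (C D : category) := Functor {
  fobj :> C -> D;
  fmap : forall x y : C, hom x y -> hom (fobj x) (fobj y);
  fmap_id : forall x, fmap (id x) = id (fobj x);
  fmap_comp : forall x y z (g : hom y z) (f : hom x y),
    fmap (g ∘ f) = fmap g ∘ fmap f
}.

Arguments fmap {C D} f {x y} _ : rename.

Definition id_functor (C : category) : functor C C :=
  @Functor C C (fun x => x) (fun x y f => f)
    (fun x => eq_refl) (fun x y z g f => eq_refl).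

Definition comp_functor (C D E : category) (G : functor D E) (F : functor C D) :
  functor C E.
Proof.
refine (@Functor C E (fun x => G (F x)) (fun x y f => fmap G (fmap F f)) _ _).
- intros x; rewrite fmap_id; apply fmap_id.
- intros x y z g f; rewrite fmap_comp; apply fmap_comp.
Defined.

Record nat_trans (C D : category) (F G : functor C D) := NatTrans {
  component :> forall x, hom (F x) (G x);
  naturality : forall x y (f : hom x y),
    component y ∘ fmap F f = fmap G f ∘ component x
}.

Record adjunction (C D : category) (L : functor C D) (R : functor D C) := Adjunction {
  adj_unit : nat_trans (id_functor C) (comp_functor R L);
  adj_counit : nat_trans (comp_functor L R) (id_functor D);
  adj_triangle_l : forall x : C, adj_counit (L x) ∘ fmap L (adj_unit x) = id (L x);
  adj_triangle_r : forall y : D, fmap R (adj_counit y) ∘ adj_unit (R y) = id (R y)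
}.

Definition has_right_adjoint (C D : category) (L : functor C D) : Prop :=
  exists R : functor D C, inhabited (adjunction L R).

Definition is_limit (J C : category) (D : functor J C) (l : C)
    (p : forall j, hom l (D j)) : Prop :=
  (forall i j (f : hom i j), fmap D f ∘ p i = p j) /\
  (forall (z : C) (q : forall j, hom z (D j)),
     (forall i j (f : hom i j), fmap D f ∘ q i = q j) ->
     exists! u : hom z l, forall j, p j ∘ u = q j).

Definition is_finite_category (J : category) : Prop :=
  Finite J /\ forall x y : J, Finite (hom x y).

Definition finitely_complete (C : category) : Prop :=
  forall J : category, is_finite_category J ->
  forall D : functor J C, exists l p, is_limit (C := C) (D := D) (l := l) p.

Definition finitely_cocomplete (C : category) : Prop := finitely_complete (op C).

(** Monicity is not imposed separately: it follows from the lifting property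
    when [C] has coequalizers. *)
Definition is_strong_mono (C : category) (x y : C) (m : hom x y) : Prop :=
  forall (a b : C) (e : hom a b), is_epi e -> lifts e m.

(** The pullback of a (possibly proper-class-sized, possibly empty) collection
    [S] of maps with common codomain [x], with apex [l], structure map [p] to
    [x] and a leg [q] to the domain of each member. *)
Definition is_wide_pullback (C : category) (x : C)
    (S : forall y : C, hom y x -> Prop) (l : C) (p : hom l x)
    (q : forall y (m : hom y x), S y m -> hom l y) : Prop :=
  (forall y m (s : S y m), m ∘ q y m s = p) /\
  (forall (z : C) (p' : hom z x) (q' : forall y (m : hom y x), S y m -> hom z y),
     (forall y m (s : S y m), m ∘ q' y m s = p') ->
     exists! u : hom z l, p ∘ u = p' /\ forall y m (s : S y m), q y m s ∘ u = q' y m s).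

Definition finitely_well_complete (C : category) : Prop :=
  finitely_complete C /\
  forall (x : C) (S : forall y : C, hom y x -> Prop),
    (forall y m, S y m -> is_strong_mono m) ->
    exists l (p : hom l x) q, is_wide_pullback (S := S) p q.

Definition finitely_co_well_complete (C : category) : Prop :=
  finitely_well_complete (op C).

Record poset := Poset {
  carrier :> Type;
  le : carrier -> carrier -> Prop;
  le_refl : forall x, le x x;
  le_trans : forall x y z, le x y -> le y z -> le x z;
  le_antisym : forall x y, le x y -> le y x -> x = y
}.

Arguments le {p} x y.

Definition poset_op (P : poset) : poset :=
  @Poset P (fun x y => le y x) (@le_refl P)
    (fun x y z h k => le_trans k h) (fun x y h k => le_antisym k h).

Definition order_isomorphic (P Q : poset) : Prop :=
  exists (f : P -> Q) (g : Q -> P),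
    (forall x, g (f x) = x) /\ (forall y, f (g y) = y) /\
    (forall x x', le x x' -> le (f x) (f x')) /\
    (forall y y', le y y' -> le (g y) (g y')).

Definition full_subcategory (C : category) (P : C -> Prop) : category :=
  @Category {x : C | P x} (fun x y => @hom C (proj1_sig x) (proj1_sig y))
    (fun x => id (proj1_sig x))
    (fun x y z g f => comp (c := C) g f)
    (fun x y f => comp_id_l f)
    (fun x y f => comp_id_r f)
    (fun w x y z h g f => comp_assoc (c := C) h g f).

Definition inclusion (C : category) (P : C -> Prop) : functor (full_subcategory P) C :=
  @Functor (full_subcategory P) C (fun x => proj1_sig x) (fun x y f => f)
    (fun x => eq_refl) (fun x y z g f => eq_refl).

Definition is_coreflective (C : category) (P : C -> Prop) : Prop :=
  has_right_adjoint (inclusion P).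

Definition is_replete (C : category) (P : C -> Prop) : Prop :=
  forall (x y : C) (f : hom x y), is_iso f -> P x -> P y.

(** A full subcategory is identified with its collection of objects. *)
Definition coRefl_carrier (C : category) : Type :=
  {P : C -> Prop | is_replete P /\ is_coreflective P}.

Definition coRefl_le (C : category) (P Q : coRefl_carrier C) : Prop :=
  forall x : C, proj1_sig P x -> proj1_sig Q x.

Lemma sig_ext (A : Type) (P : A -> Prop) (u v : {a : A | P a}) :
  proj1_sig u = proj1_sig v -> u = v.
Proof.
destruct u as [a p], v as [b q]; simpl; intros e; subst b.
now rewrite (proof_irrelevance _ p q).
Qed.

Lemma coRefl_le_antisym (C : category) (P Q : coRefl_carrier C) :
  coRefl_le P Q -> coRefl_le Q P -> P = Q.
Proof.
intros h k; apply sig_ext, functional_extensionality; intros x.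
apply propositional_extensionality; split; [apply h | apply k].
Qed.

Definition coRefl (C : category) : poset :=
  @Poset (coRefl_carrier C) (@coRefl_le C)
    (fun P x h => h) (fun P Q R h k x p => k x (h x p))
    (@coRefl_le_antisym C).

Definition morphism_class (C : category) := forall x y : C, hom x y -> Prop.

Record model_data (C : category) := ModelData {
  cof : morphism_class C;
  weq : morphism_class C;
  fib : morphism_class C
}.

Arguments cof {C} m {x y} f : rename.
Arguments weq {C} m {x y} f : rename.
Arguments fib {C} m {x y} f : rename.

Definition retract_closed (C : category) (W : morphism_class C) : Prop :=
  forall (a b x y : C) (f : hom a b) (g : hom x y),
    is_retract f g -> W x y g -> W a b f.

Record is_model_category (C : category) (M : model_data C) : Prop := {
  model_complete : finitely_complete C;
  model_cocomplete : finitely_cocomplete C;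
  cof_retract : retract_closed (@cof C M);
  weq_retract : retract_closed (@weq C M);
  fib_retract : retract_closed (@fib C M);
  factor_acyclic_cof_fib : forall (x y : C) (f : hom x y),
    exists z (i : hom x z) (p : hom z y),
      cof M i /\ weq M i /\ fib M p /\ p ∘ i = f;
  factor_cof_acyclic_fib : forall (x y : C) (f : hom x y),
    exists z (i : hom x z) (p : hom z y),
      cof M i /\ fib M p /\ weq M p /\ p ∘ i = f;
  two_of_three : forall (x y z : C) (f : hom x y) (g : hom y z),
    (weq M f -> weq M g -> weq M (g ∘ f)) /\
    (weq M f -> weq M (g ∘ f) -> weq M g) /\
    (weq M g -> weq M (g ∘ f) -> weq M f);
  cof_lifting : forall (a b : C) (f : hom a b),
    cof M f <->
    forall (x y : C) (g : hom x y), fib M g -> weq M g -> lifts f g;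
  acyclic_cof_lifting : forall (a b : C) (f : hom a b),
    (cof M f /\ weq M f) <->
    forall (x y : C) (g : hom x y), fib M g -> lifts f g
}.

Definition discrete_model (C : category) : model_data C :=
  {| cof := fun x y f => True;
     weq := fun x y f => is_iso f;
     fib := fun x y f => True |}.

Definition is_Bousfield_colocalization (C : category) (M M' : model_data C) : Prop :=
  is_model_category M' /\
  (forall (x y : C) (f : hom x y), fib M' f <-> fib M f) /\
  (forall (x y : C) (f : hom x y), weq M f -> weq M' f).

Definition coLoc_carrier (C : category) : Type :=
  {M : model_data C | is_Bousfield_colocalization (discrete_model C) M}.

Definition coLoc_le (C : category) (X Y : coLoc_carrier C) : Prop :=
  is_Bousfield_colocalization (proj1_sig X) (proj1_sig Y).

Lemma coLoc_le_refl (C : category) (X : coLoc_carrier C) : coLoc_le X X.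
Proof. split; [exact (proj1 (proj2_sig X)) | split; intros; tauto]. Qed.

Lemma coLoc_le_trans (C : category) (X Y Z : coLoc_carrier C) :
  coLoc_le X Y -> coLoc_le Y Z -> coLoc_le X Z.
Proof.
intros [_ [h1 h2]] [k0 [k1 k2]]; split; [exact k0 | split; intros x y f].
- rewrite k1; apply h1.
- intros w; apply k2, h2, w.
Qed.

Lemma morphism_class_ext (C : category) (V W : morphism_class C) :
  (forall x y (f : hom x y), V x y f <-> W x y f) -> V = W.
Proof.
intros h; do 3 (apply functional_extensionality_dep; intro).
apply propositional_extensionality, h.
Qed.

Lemma coLoc_le_antisym (C : category) (X Y : coLoc_carrier C) :
  coLoc_le X Y -> coLoc_le Y X -> X = Y.
Proof.
intros [MY [hf hw]] [MX [_ kw]]; apply sig_ext.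
destruct X as [[c w f] ?], Y as [[c' w' f'] ?]; simpl in *.
assert (ef : f = f') by (apply morphism_class_ext; intros; symmetry; apply hf).
assert (ew : w = w') by (apply morphism_class_ext; split; [apply hw | apply kw]).
subst f' w'; f_equal; apply morphism_class_ext; intros x y u.
rewrite (cof_lifting MX u), (cof_lifting MY u); reflexivity.
Qed.

Definition coLoc (C : category) : poset :=
  Poset (@coLoc_le_refl C) (@coLoc_le_trans C) (@coLoc_le_antisym C).

Lemma is_iso_id (C : category) (x : C) : is_iso (id x).
Proof. exists (id x); split; apply comp_id_l. Qed.

Lemma is_iso_comp (C : category) (x y z : C) (f : hom x y) (g : hom y z) :
  is_iso f -> is_iso g -> is_iso (g ∘ f).
Proof.
intros [f' [f1 f2]] [g' [g1 g2]]; exists (f' ∘ g'); split.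
- now rewrite <- comp_assoc, (comp_assoc g' g f), g1, comp_id_l.
- now rewrite <- comp_assoc, (comp_assoc f f' g'), f2, comp_id_l.
Qed.

Lemma discrete_model_is_model_category (C : category) :
  finitely_complete C -> finitely_cocomplete C ->
  is_model_category (discrete_model C).
Proof.
intros hl hc; split; simpl; trivial.
- intros a b x y f g _ _; exact I.
- intros a b x y f g (i & r & j & s & e1 & e2 & e3 & e4) [g' [h1 h2]].
  exists (r ∘ g' ∘ j); split.
  + now rewrite <- comp_assoc, <- e3, comp_assoc, <- (comp_assoc r g' g), h1,
      comp_id_r.
  + now rewrite !comp_assoc, e4, <- (comp_assoc s g g'), h2, comp_id_r.
- intros a b x y f g _ _; exact I.
- intros x y f; exists x, (id x), f.
  split; [exact I | split; [apply is_iso_id | split; [exact I | apply comp_id_r]]].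
- intros x y f; exists y, f, (id y).
  split; [exact I | split; [exact I | split; [apply is_iso_id | apply comp_id_l]]].
- intros x y z f g; split; [apply is_iso_comp | split].
  + intros Hf Hgf; destruct Hf as [f' [h1 h2]].
    replace g with ((g ∘ f) ∘ f') by (now rewrite <- comp_assoc, h2, comp_id_r).
    apply is_iso_comp; [exists f; now split | exact Hgf].
  + intros Hg Hgf; destruct Hg as [g' [h1 h2]].
    replace f with (g' ∘ (g ∘ f)) by (now rewrite comp_assoc, h1, comp_id_l).
    apply is_iso_comp; [exact Hgf | exists g; now split].
- intros a b f; split; [intros _ x y g _ [g' [h1 h2]] u v e | trivial].
  exists (g' ∘ v); split.
  + now rewrite <- comp_assoc, <- e, comp_assoc, h1, comp_id_l.
  + now rewrite comp_assoc, h2, comp_id_l.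
- intros a b f; split.
  + intros [_ [f' [h1 h2]]] x y g _ u v e; exists (u ∘ f'); split.
    * now rewrite <- comp_assoc, h1, comp_id_r.
    * now rewrite comp_assoc, e, <- comp_assoc, h2, comp_id_r.
  + intros h; split; [exact I |].
    destruct (h a b f I (id a) (id b)) as [d [h1 h2]].
    * now rewrite comp_id_l, comp_id_r.
    * exists d; now split.
Qed.

Record monad (C : category) := Monad {
  mfun :> functor C C;
  eta : nat_trans (id_functor C) mfun;
  mu : nat_trans (comp_functor mfun mfun) mfun;
  mu_eta_l : forall x : C, mu x ∘ eta (mfun x) = id (mfun x);
  mu_eta_r : forall x : C, mu x ∘ fmap mfun (eta x) = id (mfun x);
  mu_assoc : forall x : C, mu x ∘ mu (mfun x) = mu x ∘ fmap mfun (mu x)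
}.

Arguments eta {C} m.
Arguments mu {C} m.

Record monad_morphism (C : category) (S T : monad C) := MonadMorphism {
  mm_trans :> nat_trans S T;
  mm_eta : forall x : C, mm_trans x ∘ eta S x = eta T x;
  mm_mu : forall x : C,
    mm_trans x ∘ mu S x = mu T x ∘ (fmap T (mm_trans x) ∘ mm_trans (S x))
}.

Definition is_idempotent (C : category) (T : monad C) : Prop :=
  forall x : C, is_iso (fmap T (eta T x)) /\ is_iso (eta T (T x)).

Definition comonad (C : category) := monad (op C).

(** A morphism of comonads [T -> S] on [C] is a morphism of monads [S -> T]
    on [op C]. *)
Definition comonad_morphism (C : category) (T S : comonad C) := @monad_morphism (op C) S T.

Definition idempotent_comonad (C : category) : Type :=
  {T : comonad C | is_idempotent T}.

Definition naturally_equivalent (C : category) (S T : idempotent_comonad C) : Prop :=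
  exists phi : comonad_morphism (proj1_sig S) (proj1_sig T),
    forall x : op C, is_iso (phi x).

(** Natural equivalence classes, as subcollections of [idempotent_comonad C]. *)
Definition IdemcoMonads_carrier (C : category) : Type :=
  {K : idempotent_comonad C -> Prop |
    exists T, forall S, K S <-> naturally_equivalent T S}.

Definition IdemcoMonads_le (C : category) (K L : IdemcoMonads_carrier C) : Prop :=
  exists S T : idempotent_comonad C,
    proj1_sig K S /\ proj1_sig L T /\
    inhabited (comonad_morphism (proj1_sig T) (proj1_sig S)).

Definition monad_morphism_id (C : category) (T : monad C) : monad_morphism T T.
Proof.
unshelve refine (@MonadMorphism C T T (@NatTrans C C T T (fun x => id (T x)) _) _ _).
- intros x y f; now rewrite comp_id_l, comp_id_r.
- intros x; apply comp_id_l.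
- intros x; simpl; now rewrite fmap_id, !comp_id_l, comp_id_r.
Defined.

Definition monad_morphism_comp (C : category) (R S T : monad C)
    (psi : monad_morphism S T) (phi : monad_morphism R S) : monad_morphism R T.
Proof.
unshelve refine (@MonadMorphism C R T
  (@NatTrans C C R T (fun x => psi x ∘ phi x) _) _ _).
- intros x y f.
  now rewrite <- comp_assoc, (naturality phi), comp_assoc, (naturality psi), comp_assoc.
- intros x; pose proof (mm_eta phi x) as e; pose proof (mm_eta psi x) as e'.
  simpl in *; now rewrite <- comp_assoc, e.
- intros x; pose proof (mm_mu phi x) as e; pose proof (mm_mu psi x) as e'.
  simpl in *; rewrite <- comp_assoc, e, comp_assoc, e', fmap_comp.
  rewrite <- !comp_assoc; do 2 f_equal; rewrite !comp_assoc; f_equal.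
  apply (naturality psi).
Defined.

Lemma is_epi_of_iso (C : category) (x y : C) (f : hom x y) : is_iso f -> is_epi f.
Proof.
intros [g [_ e]] z u v h.
now rewrite <- (comp_id_r u), <- (comp_id_r v), <- e, !comp_assoc, h.
Qed.

Lemma monad_morphism_inv (C : category) (S T : monad C) (phi : monad_morphism S T) :
  (forall x, is_iso (phi x)) ->
  exists psi : monad_morphism T S, forall x, is_iso (psi x).
Proof.
intros h.
set (g := fun x => proj1_sig (constructive_indefinite_description _ (h x))).
assert (gl : forall x, g x ∘ phi x = id (S x)) by
  (intros x; apply (proj2_sig (constructive_indefinite_description _ (h x)))).
assert (gr : forall x, phi x ∘ g x = id (T x)) by
  (intros x; apply (proj2_sig (constructive_indefinite_description _ (h x)))).
clearbody g.
assert (nat : forall x y (f : hom x y), g y ∘ fmap T f = fmap S f ∘ g x).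
{ intros x y f; apply (is_epi_of_iso (h x)).
  now rewrite <- !comp_assoc, gl, <- (naturality phi), comp_assoc, gl,
    comp_id_l, comp_id_r. }
unshelve eexists (@MonadMorphism C T S (@NatTrans C C T S g nat) _ _).
- intros x; simpl; rewrite <- (mm_eta phi x), comp_assoc, gl; apply comp_id_l.
- intros x; simpl.
  assert (e : mu T x = phi x ∘ mu S x ∘ (g (S x) ∘ fmap T (g x))).
  { pose proof (mm_mu phi x) as m; simpl in *; rewrite m.
    rewrite <- !comp_assoc, (comp_assoc (phi (S x))), gr, comp_id_l.
    now rewrite <- fmap_comp, gr, fmap_id, comp_id_r. }
  simpl in *; rewrite e, !comp_assoc, gl, comp_id_l, <- comp_assoc, nat.
  apply comp_assoc.
- intros x; exists (phi x); split; [apply gr | apply gl].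
Qed.

Lemma iso_section_unique (C : category) (x y : C) (a b : hom x y) (m : hom y x) :
  is_iso a -> m ∘ a = id x -> m ∘ b = id x -> a = b.
Proof.
intros [a' [_ e]] ma mb.
assert (m = a') by now rewrite <- (comp_id_r m), <- e, comp_assoc, ma, comp_id_l.
subst a'.
now rewrite <- (comp_id_l b), <- e, <- comp_assoc, mb, comp_id_r.
Qed.

Lemma idempotent_eta_epi (C : category) (T : monad C) :
  is_idempotent T ->
  forall (x y : C) (f g : hom (T x) (T y)), f ∘ eta T x = g ∘ eta T x -> f = g.
Proof.
intros h x y.
assert (e : eta T (T x) = fmap T (eta T x)).
{ apply (@iso_section_unique C (T x) (T (T x)) _ _ (mu T x)).
  - apply h.
  - apply mu_eta_l.
  - apply mu_eta_r. }
assert (r : forall f : hom (T x) (T y), f = mu T y ∘ fmap T (f ∘ eta T x)).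
{ intros f; pose proof (naturality (eta T) f) as n; pose proof (mu_eta_l T y) as m.
  pose proof (fmap_comp T f (eta T x)) as c.
  simpl in *; rewrite c, <- e, <- n, comp_assoc, m; symmetry; apply comp_id_l. }
intros f g k; now rewrite (r f), (r g), k.
Qed.

Lemma idempotent_morphism_iso (C : category) (S T : monad C) :
  is_idempotent S -> is_idempotent T ->
  forall (phi : monad_morphism S T) (psi : monad_morphism T S) (x : C), is_iso (phi x).
Proof.
intros hS hT phi psi x; exists (psi x); split.
- apply (idempotent_eta_epi hS).
  pose proof (mm_eta phi x) as e; pose proof (mm_eta psi x) as e'; simpl in *.
  now rewrite <- comp_assoc, e, e', comp_id_l.
- apply (idempotent_eta_epi hT).
  pose proof (mm_eta phi x) as e; pose proof (mm_eta psi x) as e'; simpl in *.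
  now rewrite <- comp_assoc, e', e, comp_id_l.
Qed.

Lemma naturally_equivalent_refl (C : category) (T : idempotent_comonad C) :
  naturally_equivalent T T.
Proof. exists (monad_morphism_id (proj1_sig T)); intros x; apply is_iso_id. Qed.

Lemma naturally_equivalent_sym (C : category) (S T : idempotent_comonad C) :
  naturally_equivalent S T -> naturally_equivalent T S.
Proof. intros [phi h]; exact (monad_morphism_inv h). Qed.

Lemma naturally_equivalent_trans (C : category) (R S T : idempotent_comonad C) :
  naturally_equivalent R S -> naturally_equivalent S T -> naturally_equivalent R T.
Proof.
intros [phi h] [psi k]; exists (monad_morphism_comp phi psi).
intros x; apply is_iso_comp; [apply k | apply h].
Qed.

Lemma IdemcoMonads_class (C : category) (K : IdemcoMonads_carrier C)
    (S T : idempotent_comonad C) :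
  proj1_sig K S -> (proj1_sig K T <-> naturally_equivalent S T).
Proof.
destruct K as [K [R hR]]; simpl; rewrite !hR; intros h; split; intros k.
- exact (naturally_equivalent_trans (naturally_equivalent_sym h) k).
- exact (naturally_equivalent_trans h k).
Qed.

Lemma IdemcoMonads_le_refl (C : category) (K : IdemcoMonads_carrier C) :
  IdemcoMonads_le K K.
Proof.
destruct (proj2_sig K) as [T hT].
assert (h : proj1_sig K T) by (apply hT, naturally_equivalent_refl).
exists T, T; split; [exact h | split; [exact h |]].
exact (inhabits (monad_morphism_id (proj1_sig T))).
Qed.

Lemma IdemcoMonads_le_trans (C : category) (K L M : IdemcoMonads_carrier C) :
  IdemcoMonads_le K L -> IdemcoMonads_le L M -> IdemcoMonads_le K M.
Proof.
intros (R & S & hR & hS & [phi]) (S' & T & hS' & hT & [psi]).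
exists R, T; split; [exact hR | split; [exact hT |]].
destruct (proj1 (IdemcoMonads_class S hS') hS) as [chi _].
exact (inhabits (monad_morphism_comp psi (monad_morphism_comp chi phi))).
Qed.

Lemma IdemcoMonads_le_antisym (C : category) (K L : IdemcoMonads_carrier C) :
  IdemcoMonads_le K L -> IdemcoMonads_le L K -> K = L.
Proof.
intros (S & T & hS & hT & [phi]) (T' & S' & hT' & hS' & [psi]).
destruct (proj1 (IdemcoMonads_class T hT') hT) as [a _].
destruct (proj1 (IdemcoMonads_class S' hS) hS') as [b _].
set (psi' := monad_morphism_comp b (monad_morphism_comp psi a)
  : monad_morphism (proj1_sig T) (proj1_sig S)).
assert (e : naturally_equivalent S T).
{ exists psi'; intros x.
  exact (idempotent_morphism_iso (proj2_sig T) (proj2_sig S) psi' phi x). }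
apply sig_ext, functional_extensionality; intros R.
apply propositional_extensionality.
rewrite (IdemcoMonads_class R hS), (IdemcoMonads_class R hT); split; intros h.
- exact (naturally_equivalent_trans (naturally_equivalent_sym e) h).
- exact (naturally_equivalent_trans e h).
Qed.

Definition IdemcoMonads (C : category) : poset :=
  Poset (@IdemcoMonads_le_refl C) (@IdemcoMonads_le_trans C) (@IdemcoMonads_le_antisym C).

(* Main.v *)
(** A coreflective subcategory P corresponds to the model structure whose weak equivalences
    are the maps f such that hom(p, f) is bijective for all p in P; conversely P is the
    class of objects p such that hom(p, w) is bijective for every weak equivalence w, and
    these are the cofibrant objects. The only hard axiom is the factorization into a
    cofibration and an acyclic fibration. In the opposite category it is the theorem of
    Cassidy, Hébert and Kelly: pull back the reflection of f along the unit of its codomain,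
    then intersect all strong monomorphisms, in the right class, through which the comparison
    map factors. An idempotent comonad corresponds to the class of objects at which its
    counit is invertible. *)

From Stdlib Require Import List FunctionalExtensionality PropExtensionality ClassicalEpsilon.
Require Import Defs.

Set Implicit Arguments.
Unset Strict Implicit.

(** * Isomorphisms of partial orders *)

Lemma order_isomorphic_sym (P Q : poset) : order_isomorphic P Q -> order_isomorphic Q P.
Proof. intros (f & g & h1 & h2 & h3 & h4); exists g, f; tauto. Qed.

Lemma order_isomorphic_trans (P Q R : poset) :
  order_isomorphic P Q -> order_isomorphic Q R -> order_isomorphic P R.
Proof.
intros (f & f' & h1 & h2 & h3 & h4) (g & g' & k1 & k2 & k3 & k4).
exists (fun x => g (f x)), (fun z => f' (g' z)); repeat split; auto.
- intros x; now rewrite k1, h1.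
- intros z; now rewrite h2, k2.
Qed.

(** Reflecting the order gives injectivity by antisymmetry; choice supplies the inverse. *)
Lemma surjective_embedding_isomorphic (P Q : poset) (f : P -> Q) :
  (forall x x', le x x' <-> le (f x) (f x')) -> (forall y, exists x, f x = y) ->
  order_isomorphic P Q.
Proof.
intros emb surj.
set (g := fun y => proj1_sig (constructive_indefinite_description _ (surj y))).
assert (fg : forall y, f (g y) = y) by
  (intros y; apply (proj2_sig (constructive_indefinite_description _ (surj y)))).
exists f, g; repeat split; auto.
- intros x; apply le_antisym; apply emb; rewrite fg; apply le_refl.
- intros x x'; apply emb.
- intros y y' h; apply emb; now rewrite !fg.
Qed.

(** * Pullbacks and terminal objects as finite limits *)

Definition is_pullback (C : category) (x y z l : C) (f : hom x z) (g : hom y z)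
    (p : hom l x) (q : hom l y) : Prop :=
  f ∘ p = g ∘ q /\
  forall w (u : hom w x) (v : hom w y), f ∘ u = g ∘ v ->
    exists! h : hom w l, p ∘ h = u /\ q ∘ h = v.

Inductive cospan_ob := cospan_left | cospan_right | cospan_apex.

Definition cospan_hom (a b : cospan_ob) : Type :=
  match a, b with
  | cospan_left, cospan_left | cospan_right, cospan_right | cospan_apex, cospan_apex
  | cospan_left, cospan_apex | cospan_right, cospan_apex => unit
  | _, _ => Empty_set
  end.

Definition cospan : category.
Proof.
unshelve refine (@Category cospan_ob cospan_hom _ _ _ _ _).
- intros []; exact tt.
- intros [] [] []; simpl; intros a b; first [exact tt | now destruct a | now destruct b].
- intros [] [] []; reflexivity.
- intros [] [] []; reflexivity.
- intros [] [] [] [] [] [] []; reflexivity.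
Defined.

Lemma cospan_finite : is_finite_category cospan.
Proof.
split.
- exists (cospan_left :: cospan_right :: cospan_apex :: nil); intros []; simpl; tauto.
- intros [] []; simpl;
    solve [exists (tt :: nil); intros []; simpl; tauto | exists nil; intros []].
Qed.

Definition cospan_functor (C : category) (x y z : C) (f : hom x z) (g : hom y z) :
  functor cospan C.
Proof.
unshelve refine (@Functor cospan C
  (fun a => match a with cospan_left => x | cospan_right => y | cospan_apex => z end)
  _ _ _).
- intros [] [] a; destruct a; first [apply id | exact f | exact g].
- intros []; reflexivity.
- intros [] [] [] [] []; simpl; now rewrite ?comp_id_l, ?comp_id_r.
Defined.

Lemma pullback_exists (C : category) : finitely_complete C ->
  forall (x y z : C) (f : hom x z) (g : hom y z),
  exists l (p : hom l x) (q : hom l y), is_pullback f g p q.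
Proof.
intros hC x y z f g.
destruct (hC cospan cospan_finite (cospan_functor f g)) as (l & p & cone & univ).
exists l, (p cospan_left), (p cospan_right).
pose proof (cone cospan_left cospan_apex tt) as el.
pose proof (cone cospan_right cospan_apex tt) as er.
simpl in *; split; [congruence |].
intros w u v e.
destruct (univ w (fun a => match a with
   | cospan_left => u | cospan_right => v | cospan_apex => f ∘ u end))
  as (h & hh & uniq).
- intros [] [] []; simpl; now rewrite ?comp_id_l.
- exists h; split; [exact (conj (hh cospan_left) (hh cospan_right)) |].
  intros h' [e1 e2]; apply uniq; intros []; trivial.
  now rewrite <- el, <- comp_assoc, e1.
Qed.

Definition empty_category : category :=
  @Category Empty_set (fun x _ => match x with end) (fun x => match x with end)
    (fun x => match x with end) (fun x => match x with end)
    (fun x => match x with end) (fun x => match x with end).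

Lemma terminal_exists (C : category) : finitely_complete C ->
  exists t : C, forall x, exists! u : hom x t, True.
Proof.
intros hC.
assert (D : functor empty_category C).
{ refine (@Functor empty_category C (fun x : Empty_set => match x with end)
    (fun x => match x with end) _ _); intros []. }
destruct (hC empty_category) with (D := D) as (t & p & _ & univ).
- split; [exists nil |]; intros [].
- exists t; intros x.
  destruct (univ x (fun j => match j with end)) as (u & _ & uniq); [intros [] |].
  exists u; split; [exact I |]; intros u' _; apply uniq; intros [].
Qed.

(** * Monomorphisms and classes given by right lifting *)

Definition is_mono (C : category) (x y : C) (f : hom x y) : Prop :=
  forall z (g h : hom z x), f ∘ g = f ∘ h -> g = h.

(** Kept general in [L]: epimorphisms give the strong monomorphisms, and local equivalences give the
    right class of the factorization. *)
Definition right_lifting (C : category) (L : morphism_class C) : morphism_class C :=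
  fun x y g => forall (a b : C) (f : hom a b), L a b f -> lifts f g.

Lemma pullback_mono (C : category) (x y z l : C) (f : hom x z) (g : hom y z)
    (p : hom l x) (q : hom l y) :
  is_pullback f g p q -> is_mono g -> is_mono p.
Proof.
intros [e univ] hg w u v h.
assert (h' : q ∘ u = q ∘ v) by (apply hg; now rewrite !comp_assoc, <- e, <- !comp_assoc, h).
destruct (univ w (p ∘ v) (q ∘ v)) as (k & _ & uniq).
{ now rewrite !comp_assoc, e. }
rewrite <- (uniq u), <- (uniq v); auto.
Qed.

(** A map into the apex is determined by its composites with [p] and the legs; as the members are
    monic, [p] already determines the legs. *)
Lemma wide_pullback_mono (C : category) (x : C) (S : forall y : C, hom y x -> Prop)
    (l : C) (p : hom l x) (q : forall y (m : hom y x), S y m -> hom l y) :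
  is_wide_pullback p q -> (forall y m, S y m -> is_mono m) -> is_mono p.
Proof.
intros [e univ] hS w u v h.
destruct (univ w (p ∘ v) (fun y m s => q y m s ∘ v)) as (k & _ & uniq).
{ intros y m s; now rewrite comp_assoc, e. }
rewrite <- (uniq u), <- (uniq v); auto.
split; [exact h |]; intros y m s; apply (hS y m s).
now rewrite !comp_assoc, e.
Qed.

Section RightLifting.
Variables (C : category) (L : morphism_class C).

Lemma right_lifting_comp (x y z : C) (f : hom x y) (g : hom y z) :
  right_lifting L f -> right_lifting L g -> right_lifting L (g ∘ f).
Proof.
intros hf hg a b k hk u v h.
destruct (hg a b k hk (f ∘ u) v) as (d & d1 & d2); [now rewrite comp_assoc |].
destruct (hf a b k hk u d) as (d' & d1' & d2'); [easy |].
exists d'; split; [easy |]; now rewrite <- comp_assoc, d2'.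
Qed.

Lemma right_lifting_pullback (x y z l : C) (f : hom x z) (g : hom y z)
    (p : hom l x) (q : hom l y) :
  is_pullback f g p q -> right_lifting L g -> right_lifting L p.
Proof.
intros [e univ] hg a b k hk u v h.
destruct (hg a b k hk (q ∘ u) (f ∘ v)) as (d & d1 & d2).
{ now rewrite comp_assoc, <- e, <- !comp_assoc, h. }
destruct (univ b v d) as (t & [t1 t2] & _); [easy |].
exists t; split; [| easy].
destruct (univ a (p ∘ u) (q ∘ u)) as (s & _ & uniq).
{ now rewrite !comp_assoc, e. }
rewrite <- (uniq (t ∘ k)), <- (uniq u); auto.
now rewrite !comp_assoc, t1, t2, h, d1.
Qed.

Lemma right_lifting_wide_pullback (x : C) (S : forall y : C, hom y x -> Prop)
    (l : C) (p : hom l x) (q : forall y (m : hom y x), S y m -> hom l y) :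
  is_wide_pullback p q -> (forall y m, S y m -> right_lifting L m) -> right_lifting L p.
Proof.
intros [e univ] hS a b k hk u v h.
(* Lifts against the members are chosen all at once; over the common [v] they form a cone, which
   induces the lift against [p]. *)
assert (lift : forall y m (s : S y m), {d | d ∘ k = q y m s ∘ u /\ m ∘ d = v}).
{ intros y m s; apply constructive_indefinite_description.
  apply (hS y m s a b k hk); now rewrite comp_assoc, e. }
destruct (univ b v (fun y m s => proj1_sig (lift y m s))) as (t & [t1 t2] & _).
{ intros y m s; apply (proj2_sig (lift y m s)). }
exists t; split; [| easy].
destruct (univ a (p ∘ u) (fun y m s => q y m s ∘ u)) as (r & _ & uniq).
{ intros y m s; now rewrite comp_assoc, e. }
rewrite <- (uniq (t ∘ k)), <- (uniq u); auto.
split; [now rewrite comp_assoc, t1 |].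
intros y m s; rewrite comp_assoc, t2; apply (proj2_sig (lift y m s)).
Qed.

End RightLifting.

(** The lift is [k ∘ v]; its lower triangle commutes because it does so after the epimorphism
    [e]. *)
Lemma split_mono_strong (C : category) (x y : C) (m : hom x y) (k : hom y x) :
  k ∘ m = id x -> is_strong_mono m.
Proof.
intros km a b e he u v h.
assert (d1 : k ∘ v ∘ e = u).
{ now rewrite <- comp_assoc, <- h, comp_assoc, km, comp_id_l. }
exists (k ∘ v); split; [exact d1 |].
apply he; now rewrite <- comp_assoc, d1.
Qed.

Lemma split_mono_mono (C : category) (x y : C) (m : hom x y) (k : hom y x) :
  k ∘ m = id x -> is_mono m.
Proof.
intros km z g h e.
now rewrite <- (comp_id_l g), <- (comp_id_l h), <- km, <- !comp_assoc, e.
Qed.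

(** * Local equivalences and their factorization system *)

Definition local_equiv (D : category) (P : D -> Prop) : morphism_class D :=
  fun x y f => forall p, P p -> forall g : hom x p, exists! h : hom y p, h ∘ f = g.

(** Convertible to [local_equiv] on [op C], with source and target exchanged. *)
Definition colocal_equiv (C : category) (P : C -> Prop) : morphism_class C :=
  fun x y f => forall p, P p -> forall g : hom p y, exists! h : hom p x, f ∘ h = g.

Lemma local_equiv_epi (D : category) (P : D -> Prop) (x y : D) (f : hom x y) :
  local_equiv P f -> forall p, P p -> forall h h' : hom y p, h ∘ f = h' ∘ f -> h = h'.
Proof.
intros hf p hp h h' e; destruct (hf p hp (h' ∘ f)) as (k & _ & uniq).
now rewrite <- (uniq h), <- (uniq h').
Qed.

Lemma colocal_equiv_mono (C : category) (P : C -> Prop) (x y : C) (f : hom x y) :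
  colocal_equiv P f -> forall p, P p -> forall h h' : hom p x, f ∘ h = f ∘ h' -> h = h'.
Proof. exact (@local_equiv_epi (op C) P y x f). Qed.

(** Objectwise form of reflectivity, with no functor chosen; on [op C] it amounts to coreflectivity
    in [C]. *)
Definition has_reflections (D : category) (P : D -> Prop) : Prop :=
  forall x : D, exists r (rho : hom x r), P r /\ local_equiv P rho.

(** Locality of [x] extends [u] along [f]; locality of [y] makes the lower triangle commute. *)
Lemma local_hom_right_lifting (D : category) (P : D -> Prop) (x y : D) (g : hom x y) :
  P x -> P y -> right_lifting (local_equiv P) g.
Proof.
intros hx hy a b f hf u v e.
destruct (hf x hx u) as (d & d1 & _).
exists d; split; [exact d1 |].
apply (local_equiv_epi hf hy); now rewrite <- comp_assoc, d1.
Qed.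

Lemma reflective_factorization (D : category) (P : D -> Prop) :
  finitely_well_complete D -> has_reflections P ->
  forall (a b : D) (f : hom a b), exists w (e : hom a w) (m : hom w b),
    local_equiv P e /\ right_lifting (local_equiv P) m /\ m ∘ e = f.
Proof.
intros [lim wide] refl a b f.
destruct (refl a) as (ra & rho_a & Pra & ha).
destruct (refl b) as (rb & rho_b & Prb & hb).
destruct (ha rb Prb (rho_b ∘ f)) as (rf & erf & _).
(* As a base change of [rf], a map between local objects, [m] is in the right class. *)
destruct (pullback_exists lim rho_b rf) as (w & m & t & pb).
destruct (proj2 pb a f rho_a) as (e1 & [e1m e1t] & _); [easy |].
(* Monicity is a separate clause, as [D] is not assumed to have coequalizers. *)
set (S := fun (y : D) (n : hom y w) => is_strong_mono n /\ is_mono n /\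
  right_lifting (local_equiv P) n /\ exists e, n ∘ e = e1).
destruct (wide w S) as (v & n & q & wp).
{ now intros y k [h _]. }
assert (n_mono : is_mono n) by (apply (wide_pullback_mono wp); now intros y k (_ & h & _)).
assert (n_rl : right_lifting (local_equiv P) n).
{ apply (right_lifting_wide_pullback wp); now intros y k (_ & _ & h & _). }
assert (n_strong : is_strong_mono n).
{ apply (right_lifting_wide_pullback (L := @is_epi D) wp); now intros y k (h & _). }
assert (ex2 : exists e2, n ∘ e2 = e1).
{ assert (lift : forall y k (s : S y k), {e | k ∘ e = e1}).
  { intros y k s; apply constructive_indefinite_description, s. }
  destruct (proj2 wp a e1 (fun y k s => proj1_sig (lift y k s))) as (e2 & [h _] & _).
  - intros y k s; apply (proj2_sig (lift y k s)).
  - now exists e2. }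
destruct ex2 as [e2 ne2].
destruct (refl v) as (rv & rho_v & Prv & hv).
destruct (ha rv Prv (rho_v ∘ e2)) as (re & ere & _).
(* The extension [k] of [t ∘ n] is a retraction of [re], the reflection of [e2]. *)
destruct (hv ra Pra (t ∘ n)) as (k & ek & _).
assert (kre : k ∘ re = id ra).
{ apply (local_equiv_epi ha Pra).
  now rewrite <- comp_assoc, ere, comp_assoc, ek, <- comp_assoc, ne2, e1t, comp_id_l. }
(* The base change [n'] of the split monomorphism [re] still receives [e2], so [n ∘ n'] belongs to
   the family that [n] intersects. *)
destruct (pullback_exists lim rho_v re) as (u & n' & s & pb').
destruct (proj2 pb' a e2 rho_a) as (e3 & [n'e3 _] & _); [easy |].
assert (nn' : S u (n ∘ n')).
{ repeat split.
  - apply (right_lifting_comp (L := @is_epi D)); [| exact n_strong].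
    apply (right_lifting_pullback (L := @is_epi D) pb'), (split_mono_strong kre).
  - intros z g h e; apply (pullback_mono pb' (split_mono_mono kre)), n_mono.
    now rewrite !comp_assoc.
  - apply right_lifting_comp; [| exact n_rl].
    exact (right_lifting_pullback pb' (local_hom_right_lifting Pra Prv)).
  - exists e3; now rewrite <- comp_assoc, n'e3. }
set (c := q u (n ∘ n') nn').
(* Minimality of [n]: the pullback of [re] along the unit is invertible, hence the
   unit of [v] factors through the split monomorphism [re]. *)
assert (n'c : n' ∘ c = id v).
{ apply n_mono; rewrite comp_assoc, comp_id_r; apply (proj1 wp u _ nn'). }
assert (rv_split : re ∘ (s ∘ c) = rho_v).
{ now rewrite comp_assoc, <- (proj1 pb'), <- comp_assoc, n'c, comp_id_r. }
assert (sce2 : s ∘ c ∘ e2 = rho_a).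
{ apply (split_mono_mono kre); now rewrite comp_assoc, rv_split. }
exists v, e2, (m ∘ n); repeat split.
- intros p hp g; destruct (ha p hp g) as (g' & eg' & _).
  (* Since [s ∘ c] restricts along [e2] to the unit of [a], an extension of [g] to [ra] yields one
     to [v]. *)
  exists (g' ∘ (s ∘ c)); split.
  + now rewrite <- comp_assoc, sce2.
  + intros h <-.
    (* Any extension [h] factors through [rho_v], hence through [s ∘ c], so the comparison takes
       place on [ra]. *)
    destruct (hv p hp h) as (h' & eh' & _).
    rewrite <- eh', <- rv_split, (comp_assoc h' re); f_equal.
    apply (local_equiv_epi ha hp).
    now rewrite eg', <- comp_assoc, ere, comp_assoc, eh'.
- apply right_lifting_comp; [exact n_rl |].
  exact (right_lifting_pullback pb (local_hom_right_lifting Pra Prb)).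
- now rewrite <- comp_assoc, ne2.
Qed.

(** * Chosen reflections and coreflective subcategories *)

(** Reflections as data, from which functors and monads can be defined; the last two fields split
    unique extension into existence and uniqueness. *)
Record reflector (D : category) (P : D -> Prop) := Reflector {
  refl_ob : D -> D;
  refl_unit : forall x, hom x (refl_ob x);
  refl_ext : forall x p, P p -> hom x p -> hom (refl_ob x) p;
  refl_local : forall x, P (refl_ob x);
  refl_ext_unit : forall x p (hp : P p) (g : hom x p), refl_ext hp g ∘ refl_unit x = g;
  refl_ext_unique : forall x p, P p -> forall h h' : hom (refl_ob x) p,
    h ∘ refl_unit x = h' ∘ refl_unit x -> h = h'
}.

Lemma reflector_exists (D : category) (P : D -> Prop) :
  has_reflections P -> inhabited (reflector P).
Proof.
intros refl.
assert (choice : forall x, {r : D & {rho : hom x r | P r /\ local_equiv P rho}}).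
{ intros x; destruct (constructive_indefinite_description _ (refl x)) as [r hr].
  exists r; exact (constructive_indefinite_description _ hr). }
set (rho := fun x => proj1_sig (projT2 (choice x))).
assert (h : forall x, P (projT1 (choice x)) /\ local_equiv P (rho x)) by
  (intros x; apply (proj2_sig (projT2 (choice x)))).
assert (ext : forall x p (hp : P p) (g : hom x p), {k | k ∘ rho x = g}).
{ intros x p hp g; apply constructive_indefinite_description.
  destruct (proj2 (h x) p hp g) as (k & e & _); now exists k. }
constructor.
apply (@Reflector D P (fun x => projT1 (choice x)) rho
  (fun x p hp g => proj1_sig (ext x p hp g))).
- intros x; apply h.
- intros x p hp g; apply (proj2_sig (ext x p hp g)).
- intros x p hp k k'; exact (local_equiv_epi (proj2 (h x)) hp (h' := k')).
Qed.

(** The counit at [x] is the coreflection. A map [g] from an object of [P] lifts to its transpose;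
    one triangle identity gives existence, the other uniqueness. *)
Lemma coreflective_has_reflections (C : category) (P : C -> Prop) :
  is_coreflective P -> has_reflections (D := op C) P.
Proof.
intros [R [A]] x.
exists (proj1_sig (R x)), (adj_counit A x); split; [exact (proj2_sig (R x)) |].
intros p hp; simpl; intros g.
set (p' := exist P p hp : full_subcategory P).
exists (fmap R g ∘ adj_unit A p'); split.
- pose proof (naturality (adj_counit A) (x := p) g) as n.
  pose proof (adj_triangle_l A p') as tr.
  simpl in *; rewrite comp_assoc, n, <- comp_assoc, tr; apply comp_id_r.
- intros h <-.
  pose proof (naturality (adj_unit A) (x := p') (y := R x) h) as n.
  pose proof (adj_triangle_r A x) as tr.
  pose proof (@fmap_comp C _ R p _ x (adj_counit A x) h) as c.
  simpl in *; rewrite c, <- comp_assoc, <- n, comp_assoc, tr; apply comp_id_l.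
Qed.

Lemma has_reflections_coreflective (C : category) (P : C -> Prop) :
  has_reflections (D := op C) P -> is_coreflective P.
Proof.
intros refl; destruct (reflector_exists refl) as [F].
(* The reflector on [op C] is restated with arrows and composition of [C] before its fields are made
   opaque. *)
set (r := refl_ob F : C -> C).
set (rho := refl_unit F : forall x : C, hom (r x) x).
set (ext := refl_ext F : forall x p : C, P p -> hom p x -> hom p (r x)).
assert (loc : forall x, P (r x)) by exact (refl_local F).
assert (ext_eq : forall x p hp g, rho x ∘ ext x p hp g = g) by exact (@refl_ext_unit _ _ F).
assert (ext_uniq : forall x p, P p -> forall h h' : hom p (r x),
  rho x ∘ h = rho x ∘ h' -> h = h') by exact (@refl_ext_unique _ _ F).
clearbody r rho ext.
unshelve epose (R := @Functor C (full_subcategory P) (fun x => exist P (r x) (loc x))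
  (fun x y f => ext y (r x) (loc x) (f ∘ rho x)) _ _).
- intros x; apply ext_uniq; [apply loc |]; simpl.
  now rewrite (ext_eq x (r x)), comp_id_l, comp_id_r.
- intros x y z g f; apply ext_uniq; [apply loc |]; simpl.
  now rewrite (ext_eq z (r x)), comp_assoc, (ext_eq z (r y)), <- !comp_assoc,
    (ext_eq y (r x)).
- exists R; constructor; unshelve refine (@Adjunction (full_subcategory P) C (inclusion P) R
    (@NatTrans _ _ (id_functor (full_subcategory P)) (comp_functor R (inclusion P))
       (fun p : full_subcategory P => ext _ _ (proj2_sig p) (id (proj1_sig p))) _)
    (@NatTrans _ _ (comp_functor (inclusion P) R) (id_functor C) rho _) _ _); simpl.
  + intros p p' f; apply ext_uniq; [apply proj2_sig |].
    now rewrite !comp_assoc, !ext_eq, <- comp_assoc, ext_eq, comp_id_l, comp_id_r.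
  + intros x y f; apply ext_eq.
  + intros p; apply ext_eq.
  + intros x; apply ext_uniq; [apply loc |].
    now rewrite comp_assoc, ext_eq, <- comp_assoc, ext_eq.
Qed.

(** * The model structure of a coreflective subcategory *)

Lemma is_replete_op (C : category) (P : C -> Prop) :
  is_replete P -> is_replete (C := op C) P.
Proof.
intros h x y f [g [h1 h2]] hx; apply (h x y g); [exists f; now split | exact hx].
Qed.

Lemma lifts_op (C : category) (a b x y : C) (f : hom a b) (g : hom x y) :
  lifts (C := op C) (a := y) (b := x) (x := b) (y := a) g f -> lifts f g.
Proof.
intros h u v e; destruct (h v u (eq_sym e)) as (d & d1 & d2); exists d; now split.
Qed.

Section ColocalEquiv.
Variables (C : category) (P : C -> Prop).

Lemma colocal_equiv_iso (x y : C) (f : hom x y) : is_iso f -> colocal_equiv P f.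
Proof.
intros [f' [h1 h2]] p hp g; exists (f' ∘ g); split.
- now rewrite comp_assoc, h2, comp_id_l.
- intros h <-; now rewrite comp_assoc, h1, comp_id_l.
Qed.

Lemma colocal_equiv_comp (x y z : C) (f : hom x y) (g : hom y z) :
  colocal_equiv P f -> colocal_equiv P g -> colocal_equiv P (g ∘ f).
Proof.
intros hf hg p hp k.
destruct (hg p hp k) as (k1 & e1 & _); destruct (hf p hp k1) as (k2 & e2 & _).
exists k2; split.
- now rewrite <- comp_assoc, e2.
- intros h e; apply (colocal_equiv_mono hf hp), (colocal_equiv_mono hg hp).
  now rewrite e2, e1, comp_assoc.
Qed.

Lemma colocal_equiv_cancel_r (x y z : C) (f : hom x y) (g : hom y z) :
  colocal_equiv P f -> colocal_equiv P (g ∘ f) -> colocal_equiv P g.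
Proof.
intros hf hgf p hp k.
destruct (hgf p hp k) as (h & e & _).
exists (f ∘ h); split; [now rewrite comp_assoc |].
intros k' e'; destruct (hf p hp k') as (h' & <- & _); f_equal.
apply (colocal_equiv_mono hgf hp); now rewrite e, <- comp_assoc.
Qed.

Lemma colocal_equiv_cancel_l (x y z : C) (f : hom x y) (g : hom y z) :
  colocal_equiv P g -> colocal_equiv P (g ∘ f) -> colocal_equiv P f.
Proof.
intros hg hgf p hp k.
destruct (hgf p hp (g ∘ k)) as (h & e & _).
exists h; split.
- apply (colocal_equiv_mono hg hp); now rewrite comp_assoc.
- intros h' <-; apply (colocal_equiv_mono hgf hp); now rewrite e, comp_assoc.
Qed.

Lemma colocal_equiv_retract : retract_closed (colocal_equiv P).
Proof.
intros a b x y f g (i & r & j & s & e1 & e2 & e3 & e4) hg p hp k.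
destruct (hg p hp (j ∘ k)) as (h & e & _).
exists (r ∘ h); split.
- now rewrite comp_assoc, e4, <- comp_assoc, e, comp_assoc, e2, comp_id_l.
- intros h' <-.
  assert (h = i ∘ h') as ->.
  { apply (colocal_equiv_mono hg hp); now rewrite e, !comp_assoc, e3. }
  now rewrite comp_assoc, e1, comp_id_l.
Qed.

(** A Whitehead theorem: lifting the identity of [y] gives a right inverse, and uniqueness of lifts
    from [x] makes it two-sided. *)
Lemma colocal_equiv_is_iso (x y : C) (f : hom x y) :
  P x -> P y -> colocal_equiv P f -> is_iso f.
Proof.
intros hx hy hf; destruct (hf y hy (id y)) as (g & e & _); exists g; split; [| exact e].
apply (colocal_equiv_mono hf hx); now rewrite comp_assoc, e, comp_id_l, comp_id_r.
Qed.

(** As every map is a fibration, the cofibrations must be given by lifting against all weak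
    equivalences. *)
Definition coreflection_model : model_data C :=
  {| cof := fun a b f => forall x y (g : hom x y), colocal_equiv P g -> lifts f g;
     weq := colocal_equiv P;
     fib := fun x y f => True |}.

Lemma coreflection_model_is_model_category :
  finitely_complete C -> finitely_co_well_complete C -> is_coreflective P ->
  is_model_category coreflection_model.
Proof.
intros lim cowell refl; split; simpl.
- exact lim.
- exact (proj1 cowell).
- intros a b x y f g (i & r & j & s & e1 & e2 & e3 & e4) hg c d w hw u v e.
  destruct (hg c d w hw (u ∘ r) (v ∘ s)) as (t & t1 & t2).
  { now rewrite comp_assoc, e, <- !comp_assoc, e4. }
  exists (t ∘ j); split.
  + now rewrite <- comp_assoc, <- e3, comp_assoc, t1, <- comp_assoc, e1, comp_id_r.
  + now rewrite comp_assoc, t2, <- comp_assoc, e2, comp_id_r.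
- exact colocal_equiv_retract.
- intros a b x y f g _ _; exact I.
- intros x y f; exists x, (id x), f; repeat split.
  + intros a b g _ u v e; exists u; split; [apply comp_id_r | now rewrite e, comp_id_r].
  + apply colocal_equiv_iso, is_iso_id.
  + apply comp_id_r.
- intros x y f.
  (* Passing to [op C] swaps the factors: [m] comes first and is a cofibration, [e] comes second and
     is an acyclic fibration. *)
  destruct (@reflective_factorization (op C) P cowell
    (coreflective_has_reflections refl) y x f) as (w & e & m & he & hm & em).
  exists w, m, e; repeat split; [| exact he | exact em].
  intros c d g hg; apply lifts_op, hm, hg.
- intros x y z f g; split; [| split].
  + apply colocal_equiv_comp.
  + apply colocal_equiv_cancel_r.
  + apply colocal_equiv_cancel_l.
- firstorder.
- intros a b f; split.
  + intros [hc hw] x y g _ u v e.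
    (* An acyclic cofibration lifts against itself; in the square of identities the lift is an
       inverse. *)
    destruct (hc a b f hw (id a) (id b)) as (d & d1 & d2).
    { now rewrite comp_id_l, comp_id_r. }
    exists (u ∘ d); split.
    * now rewrite <- comp_assoc, d1, comp_id_r.
    * now rewrite comp_assoc, e, <- comp_assoc, d2, comp_id_r.
  + intros h; split; [intros x y g _; apply h, I |].
    apply colocal_equiv_iso.
    destruct (h a b f I (id a) (id b)) as (d & d1 & d2).
    { now rewrite comp_id_l, comp_id_r. }
    exists d; now split.
Qed.

End ColocalEquiv.

(** * Cofibrant objects of a colocalization *)

Section Colocalization.
Variables (C : category) (M : model_data C).
Hypothesis coloc : is_Bousfield_colocalization (discrete_model C) M.

Let model : is_model_category M := proj1 coloc.

Let all_fib (x y : C) (f : hom x y) : fib M f.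
Proof. apply coloc; exact I. Qed.

(** Lifting is required to be unique, which puts [p] in the form of a colocal object. The weak
    equivalences here are exactly the acyclic fibrations. *)
Definition cofibrant_objects (p : C) : Prop :=
  forall x y (f : hom x y), weq M f ->
  forall g : hom p y, exists! h : hom p x, f ∘ h = g.

Lemma cofibrant_objects_replete : is_replete cofibrant_objects.
Proof.
intros p p' i [j [ji ij]] hp x y f hf g.
destruct (hp x y f hf (g ∘ i)) as (h & e & uniq).
exists (h ∘ j); split.
- now rewrite comp_assoc, e, <- comp_assoc, ij, comp_id_r.
- intros h' <-; rewrite (uniq (h' ∘ i)); [| apply comp_assoc].
  now rewrite <- comp_assoc, ij, comp_id_r.
Qed.

Lemma weq_pullback (x y z l : C) (f : hom x z) (g : hom y z) (p : hom l x) (q : hom l y) :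
  is_pullback f g p q -> weq M g -> weq M p.
Proof.
intros [e univ] hg.
(* Retract argument: [p] is a retract of the acyclic fibration [b] in a factorization. *)
destruct (factor_cof_acyclic_fib model p) as (w & a & b & ha & _ & hb & ba).
destruct (proj1 (cof_lifting model a) ha y z g (all_fib g) hg q (f ∘ b)) as (d & d1 & d2).
{ now rewrite <- comp_assoc, ba. }
destruct (univ w b d) as (r & [r1 r2] & _); [easy |].
apply (weq_retract model (g := b)); [| exact hb].
exists a, r, (id x), (id x); repeat split; rewrite ?comp_id_l; auto.
destruct (univ l p q e) as (k & _ & uniq).
rewrite <- (uniq (r ∘ a)), (uniq (id l)); auto.
- now rewrite !comp_id_r.
- now rewrite !comp_assoc, r1, r2.
Qed.

(** Factor the map from the initial object to [x]; the middle object has lifts against all weak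
    equivalences, and these lifts turn out to be unique. *)
Lemma cofibrant_replacement (x : C) :
  exists c (w : hom c x), cofibrant_objects c /\ weq M w.
Proof.
destruct (terminal_exists (model_cocomplete model)) as [o ho]; simpl in o, ho.
destruct (ho x) as (ox & _ & _); simpl in ox.
destruct (factor_cof_acyclic_fib model ox) as (c & i & w & hi & _ & hw & _).
assert (from_o : forall z (u v : hom o z), u = v).
{ intros z u v; destruct (ho z) as (k & _ & uniq).
  now rewrite <- (uniq u I), <- (uniq v I). }
assert (surj : forall y z (f : hom y z), weq M f -> forall g : hom c z, exists h, f ∘ h = g).
{ intros y z f hf g.
  destruct (ho y) as (oy & _ & _); simpl in oy.
  destruct (proj1 (cof_lifting model i) hi y z f (all_fib f) hf oy g) as (h & _ & e).
  - apply from_o.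
  - now exists h. }
exists c, w; split; [| exact hw].
intros y z f hf g; destruct (surj y z f hf g) as [h <-].
exists h; split; [reflexivity |]; intros h' e'.
(* The diagonal of [f] is again a weak equivalence, and lifting against it gives
   uniqueness. *)
destruct (pullback_exists (model_complete model) f f) as (l & p & q & pb).
destruct (proj2 pb y (id y) (id y) eq_refl) as (diag & [dp dq] & _).
assert (hd : weq M diag).
{ apply (two_of_three model diag p); [exact (weq_pullback pb hf) |].
  rewrite dp; apply coloc; exact (is_iso_id y). }
destruct (proj2 pb c h h' (eq_sym e')) as (k & [<- <-] & _).
destruct (surj y l diag hd k) as [t <-].
now rewrite !comp_assoc, dp, dq.
Qed.

Lemma cofibrant_objects_coreflective : is_coreflective cofibrant_objects.
Proof.
apply has_reflections_coreflective; intros x.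
destruct (cofibrant_replacement x) as (c & w & hc & hw).
exists c, w; split; [exact hc |]; intros p hp g; exact (hp c x w hw g).
Qed.

(** A colocal equivalence induces a colocal equivalence of cofibrant replacements, which is
    invertible by the Whitehead argument; two-out-of-three then returns to [f]. *)
Lemma weq_iff_colocal_equiv (x y : C) (f : hom x y) :
  weq M f <-> colocal_equiv cofibrant_objects f.
Proof.
assert (weq_coloc : forall x y (g : hom x y), weq M g -> colocal_equiv cofibrant_objects g)
  by (intros a b g hg p hp k; exact (hp a b g hg k)).
split; [apply weq_coloc |]; intros hf.
destruct (cofibrant_replacement x) as (cx & wx & hcx & hwx).
destruct (cofibrant_replacement y) as (cy & wy & hcy & hwy).
destruct (weq_coloc _ _ wy hwy cx hcx (f ∘ wx)) as (cf & e & _).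
assert (iso : is_iso cf).
{ apply (colocal_equiv_is_iso hcx hcy).
  apply (colocal_equiv_cancel_l (weq_coloc _ _ wy hwy)); rewrite e.
  exact (colocal_equiv_comp (weq_coloc _ _ wx hwx) hf). }
apply (two_of_three model wx f); [exact hwx |].
rewrite <- e; apply (two_of_three model cf wy); [| exact hwy].
apply coloc; exact iso.
Qed.

End Colocalization.

(** Lifting the identity of [x] against its coreflection shows the latter to be invertible, and
    repleteness puts [x] in [P]. *)
Lemma cofibrant_coreflection_model (C : category) (P : C -> Prop) (x : C) :
  is_replete P -> is_coreflective P ->
  (cofibrant_objects (coreflection_model P) x <-> P x).
Proof.
intros rep corefl; split; intros hx.
- destruct (coreflective_has_reflections corefl x) as (r & rho & hr & loc); simpl in *.
  destruct (hx r x rho loc (id x)) as (s & e & _).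
  apply (rep r x rho); [| exact hr].
  exists s; split; [| exact e].
  apply (colocal_equiv_mono (P := P) (f := rho) loc hr).
  now rewrite comp_assoc, e, comp_id_l, comp_id_r.
- intros y z f hf g; exact (hf x hx g).
Qed.

Lemma coLoc_le_iff (C : category) (X Y : coLoc C) :
  le X Y <-> forall (x y : C) (f : hom x y), weq (proj1_sig X) f -> weq (proj1_sig Y) f.
Proof.
destruct X as [M hM], Y as [N hN]; split; simpl.
- intros [_ [_ h]]; exact h.
- intros h; split; [exact (proj1 hN) | split; [| exact h]]; simpl.
  intros x y f; rewrite (proj1 (proj2 hM)), (proj1 (proj2 hN)); reflexivity.
Qed.

Definition coLoc_to_coRefl (C : category) (X : coLoc C) : poset_op (coRefl C) :=
  exist (fun P : C -> Prop => is_replete P /\ is_coreflective P)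
    (cofibrant_objects (proj1_sig X))
    (conj (cofibrant_objects_replete (M := proj1_sig X))
          (cofibrant_objects_coreflective (proj2_sig X))).

(** More weak equivalences mean fewer cofibrant objects, and each class determines the other. *)
Lemma coLoc_coRefl_isomorphic (C : category) :
  finitely_complete C -> finitely_co_well_complete C ->
  order_isomorphic (coLoc C) (poset_op (coRefl C)).
Proof.
intros lim cowell; apply (surjective_embedding_isomorphic (f := @coLoc_to_coRefl C)).
- intros X Y; rewrite coLoc_le_iff; split; simpl.
  + intros h p hp x y f hf g; apply hp, h, hf.
  + intros h x y f.
    rewrite (weq_iff_colocal_equiv (proj2_sig X)), (weq_iff_colocal_equiv (proj2_sig Y)).
    intros hf p hp; apply hf, h, hp.
- intros [P [rep corefl]].
  assert (model := coreflection_model_is_model_category lim cowell corefl).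
  unshelve eexists (exist _ (coreflection_model P) _).
  + split; [exact model | split; simpl; [tauto |]].
    intros x y f; apply colocal_equiv_iso.
  + apply sig_ext, functional_extensionality; intros x.
    apply propositional_extensionality; exact (cofibrant_coreflection_model x rep corefl).
Qed.

(** * Local objects of an idempotent monad *)

(** For idempotent [T] this is the essential image of [T]. *)
Definition monad_local (D : category) (T : monad D) (x : D) : Prop := is_iso (eta T x).

Section IdempotentMonad.
Variables (D : category) (T : monad D).
Hypothesis idem : is_idempotent T.

Lemma monad_local_ext_unique (z y : D) (f g : hom (T z) y) :
  monad_local T y -> f ∘ eta T z = g ∘ eta T z -> f = g.
Proof.
intros [k [h _]] e; simpl in *.
assert (e' : eta T y ∘ f = eta T y ∘ g).
{ apply (idempotent_eta_epi idem); simpl; now rewrite <- !comp_assoc, e. }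
simpl in *; now rewrite <- (comp_id_l f), <- (comp_id_l g), <- h, <- !comp_assoc, e'.
Qed.

(** A left inverse of the unit is two-sided, since endomorphisms of [T x] are determined on the
    unit. *)
Lemma monad_local_of_retraction (x : D) (k : hom (T x) x) :
  k ∘ eta T x = id x -> monad_local T x.
Proof.
intros h; exists k; split; [exact h |].
apply (idempotent_eta_epi idem); simpl in *; now rewrite <- comp_assoc, h, comp_id_l, comp_id_r.
Qed.

Lemma monad_local_replete : is_replete (monad_local T).
Proof.
intros x y f [g [h1 h2]] [k [k1 k2]].
apply (@monad_local_of_retraction y (f ∘ k ∘ fmap T g)).
pose proof (naturality (eta T) g) as n; simpl in *.
now rewrite <- comp_assoc, <- n, comp_assoc, <- (comp_assoc f k), k1, comp_id_r.
Qed.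

Lemma monad_local_reflections : has_reflections (monad_local T).
Proof.
intros x; exists (T x), (eta T x); split; [apply idem |].
intros p hp g; pose proof hp as [k [k1 k2]].
pose proof (naturality (eta T) g) as n; simpl in *.
exists (k ∘ fmap T g); split.
- now rewrite <- comp_assoc, <- n, comp_assoc, k1, comp_id_l.
- intros h <-; apply (monad_local_ext_unique hp).
  pose proof (naturality (eta T) (h ∘ eta T x)) as n'; simpl in *.
  now rewrite <- comp_assoc, <- n', comp_assoc, k1, comp_id_l.
Qed.

End IdempotentMonad.

Lemma monad_morphism_local (D : category) (S T : monad D) :
  is_idempotent S -> monad_morphism S T ->
  forall x, monad_local T x -> monad_local S x.
Proof.
intros idem phi x [k [k1 _]].
apply (@monad_local_of_retraction D S idem x (k ∘ phi x)).
pose proof (mm_eta phi x) as e; simpl in *; now rewrite <- comp_assoc, e.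
Qed.

(** As [T x] is local for [S], the unit of [T] extends along that of [S]. Naturality and
    compatibility with [mu] need only be checked on units. *)
Lemma monad_local_morphism (D : category) (S T : monad D) :
  is_idempotent S -> is_idempotent T ->
  (forall x, monad_local T x -> monad_local S x) -> inhabited (monad_morphism S T).
Proof.
intros idS idT sub.
assert (ext : forall x, {phi : hom (S x) (T x) | phi ∘ eta S x = eta T x}).
{ intros x; apply constructive_indefinite_description.
  destruct (sub (T x) (proj2 (idT x))) as [k [k1 _]].
  pose proof (naturality (eta S) (eta T x)) as n; simpl in *.
  exists (k ∘ fmap S (eta T x)); simpl; now rewrite <- comp_assoc, <- n, comp_assoc, k1, comp_id_l. }
set (phi := fun x => proj1_sig (ext x)).
assert (phi_eta : forall x, phi x ∘ eta S x = eta T x) by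
  (intros x; apply (proj2_sig (ext x))).
clearbody phi.
assert (uniq : forall z y (f g : hom (S z) (T y)), f ∘ eta S z = g ∘ eta S z -> f = g).
{ intros z y f g; apply (monad_local_ext_unique idS), sub, idT. }
constructor; unshelve eapply (@MonadMorphism D S T (@NatTrans D D S T phi _)).
- intros x y f; apply uniq.
  pose proof (naturality (eta S) f) as nS; pose proof (naturality (eta T) f) as nT.
  simpl in *.
  now rewrite <- !comp_assoc, phi_eta, <- nS, comp_assoc, phi_eta.
- exact phi_eta.
- intros x; simpl; apply uniq.
  pose proof (naturality (eta T) (phi x)) as nT.
  pose proof (mu_eta_l S x) as mS; pose proof (mu_eta_l T x) as mT; simpl in *.
  rewrite <- !comp_assoc, mS, phi_eta, <- nT, comp_assoc, mT.
  now rewrite comp_id_l, comp_id_r.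
Qed.

(** * The idempotent monad of a reflector *)

Section ReflectorMonad.
Variables (D : category) (P : D -> Prop) (F : reflector P).

Definition reflector_functor : functor D D.
Proof.
refine (@Functor D D (refl_ob F)
  (fun x y f => refl_ext F (refl_local F y) (refl_unit F y ∘ f)) _ _).
- intros x; apply (refl_ext_unique (r := F) (refl_local F x)).
  now rewrite refl_ext_unit, comp_id_l, comp_id_r.
- intros x y z g f; apply (refl_ext_unique (r := F) (refl_local F z)).
  now rewrite refl_ext_unit, <- comp_assoc, refl_ext_unit, !comp_assoc, refl_ext_unit.
Defined.

Definition reflector_monad : monad D.
Proof.
unshelve refine (@Monad D reflector_functor
  (@NatTrans D D (id_functor D) reflector_functor (refl_unit F) _)
  (@NatTrans D D (comp_functor reflector_functor reflector_functor) reflector_functor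
     (fun x => refl_ext F (refl_local F x) (id (refl_ob F x))) _) _ _ _); simpl.
- intros x y f; now rewrite refl_ext_unit.
- intros x y f; apply (refl_ext_unique (r := F) (refl_local F y)).
  now rewrite <- !comp_assoc, !refl_ext_unit, comp_assoc, !refl_ext_unit, comp_id_l, comp_id_r.
- intros x; apply refl_ext_unit.
- intros x; apply (refl_ext_unique (r := F) (refl_local F x)).
  now rewrite <- comp_assoc, refl_ext_unit, comp_assoc, refl_ext_unit.
- intros x; apply (refl_ext_unique (r := F) (refl_local F x)).
  now rewrite <- !comp_assoc, !refl_ext_unit, comp_assoc, refl_ext_unit, comp_id_l, comp_id_r.
Defined.

Lemma reflector_unit_iso (x : D) : P x -> is_iso (refl_unit F x).
Proof.
intros hx; exists (refl_ext F hx (id x)); split; [apply refl_ext_unit |].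
apply (refl_ext_unique (r := F) (refl_local F x)).
now rewrite <- comp_assoc, refl_ext_unit, comp_id_l, comp_id_r.
Qed.

Lemma reflector_monad_idempotent : is_idempotent reflector_monad.
Proof.
intros x.
(* Both maps extend the same composite of units, so they agree. *)
assert (e : fmap reflector_monad (eta reflector_monad x)
            = eta reflector_monad (reflector_monad x)).
{ apply (refl_ext_unique (r := F) (refl_local F _)); simpl; apply refl_ext_unit. }
rewrite e; split; exact (reflector_unit_iso (refl_local F x)).
Qed.

Lemma reflector_monad_local (x : D) :
  is_replete P -> (monad_local reflector_monad x <-> P x).
Proof.
intros rep; split; [| apply reflector_unit_iso].
intros [k [k1 k2]]; apply (rep (refl_ob F x) x k); [| apply refl_local].
exists (refl_unit F x); now split.
Qed.

End ReflectorMonad.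

(** * Idempotent comonads and coreflective subcategories *)

(** Equal local classes give comonad morphisms in both directions, and between idempotent comonads
    these are mutually inverse. *)
Lemma naturally_equivalent_iff_local (C : category) (S T : idempotent_comonad C) :
  naturally_equivalent S T <->
  forall x : op C, monad_local (proj1_sig S) x <-> monad_local (proj1_sig T) x.
Proof.
destruct S as [S hS], T as [T hT]; split; simpl.
- intros e x.
  destruct (naturally_equivalent_sym e) as [psi _]; destruct e as [phi _]; simpl in *.
  split; [exact (monad_morphism_local hT phi (x := x)) |
          exact (monad_morphism_local hS psi (x := x))].
- intros h.
  destruct (@monad_local_morphism (op C) T S hT hS) as [phi]; [apply h |].
  destruct (@monad_local_morphism (op C) S T hS hT) as [psi]; [apply h |].
  exists phi; exact (idempotent_morphism_iso hT hS phi psi).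
Qed.

Lemma coreflective_idempotent_comonad (C : category) (P : coRefl_carrier C) :
  exists T : idempotent_comonad C,
    forall x : op C, monad_local (proj1_sig T) x <-> proj1_sig P x.
Proof.
destruct P as [P [rep corefl]]; simpl.
destruct (reflector_exists (coreflective_has_reflections corefl)) as [F].
exists (exist _ (reflector_monad F) (reflector_monad_idempotent F)).
intros x; exact (reflector_monad_local F x (is_replete_op rep)).
Qed.

(** The equivalence class is described by its local objects, so no coreflector has to be chosen. *)
Definition coRefl_to_IdemcoMonads (C : category) (P : poset_op (coRefl C)) :
  IdemcoMonads C.
Proof.
exists (fun S : idempotent_comonad C =>
  forall x : op C, monad_local (proj1_sig S) x <-> proj1_sig P x).
destruct (coreflective_idempotent_comonad P) as [T hT]; exists T; intros S.
rewrite naturally_equivalent_iff_local; split; intros h x; rewrite ?h, ?hT; try tauto.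
now rewrite <- h, hT.
Defined.

Lemma coRefl_IdemcoMonads_isomorphic (C : category) :
  order_isomorphic (poset_op (coRefl C)) (IdemcoMonads C).
Proof.
apply (surjective_embedding_isomorphic (f := @coRefl_to_IdemcoMonads C)).
- intros P Q; split; simpl.
  + intros h.
    destruct (coreflective_idempotent_comonad P) as [S hS].
    destruct (coreflective_idempotent_comonad Q) as [T hT].
    exists S, T; split; [exact hS | split; [exact hT |]].
    apply (@monad_local_morphism (op C) _ _ (proj2_sig S) (proj2_sig T)).
    intros x hx; apply hS, h, hT, hx.
  + intros (S & T & hS & hT & [phi]) x hx; simpl in *.
    apply hS, (monad_morphism_local (proj2_sig S) phi), hT, hx.
- intros [K [T hT]].
  unshelve eexists (exist _ (monad_local (proj1_sig T) : C -> Prop) _).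
  + split.
    (* Repleteness in [op (op C)] unfolds to repleteness in [C]. *)
    * apply (is_replete_op (C := op C)).
      exact (monad_local_replete (proj2_sig T)).
    * apply has_reflections_coreflective.
      exact (monad_local_reflections (proj2_sig T)).
  + apply sig_ext, functional_extensionality; intros S; simpl.
    apply propositional_extensionality.
    rewrite hT, naturally_equivalent_iff_local; split; intros h x; symmetry; apply h.
Qed.

Theorem mainTheorem4 (C : category) :
  finitely_complete C ->
  finitely_co_well_complete C ->
  order_isomorphic (poset_op (coRefl C)) (coLoc C) /\
  order_isomorphic (coLoc C) (IdemcoMonads C).
Proof.
intros lim cowell.
assert (h := coLoc_coRefl_isomorphic lim cowell); split.
- exact (order_isomorphic_sym h).
- exact (order_isomorphic_trans h (coRefl_IdemcoMonads_isomorphic C)).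
Qed.
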